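(* Let $n\ge 1$. For metric sequential transportation games with $n$ players (and any number $m\ge2$ of buses), $\mathrm{SPoS}(D)\ge n$, even when restricted to games in which all buses have the same permutation. That is, if $\mathcal{G}$ is the class of metric sequential transportation games with $n$ players in which $\pi_1=\dots=\pi_m$, then $\mathrm{SPoS}(D,\mathcal{G})\ge n$.
   Context: Transportation game. An instance $\Gamma$ consists of a set of players $N=\{1,\dots,n\}$ ($n\ge 1$), a set of buses $M=\{1,\dots,m\}$ with $m\ge 2$, a complete undirected graph on the vertex set $V=N\cup\{s,t\}$ ($s$ the source, $t$ the destination) with a distance function $d$ assigning a nonnegative real $d(x,y)=d(y,x)$ to each edge (with $d(x,x)=0$), and for each bus $j\in M$ a permutation $\pi_j$ of $N$. The instance is metric if $d(x,w)\le d(x,y)+d(y,w)$ for all $x,y,w\in V$. Distances between distinct vertices may be $0$. An outcome is a map $\sigma:N\to M$, $\sigma_i$ being the bus chosen by player $i$; $\mathcal{P}$ is the set of outcomes. Given $\sigma$, bus $j$ starts at $s$, visits exactly the players $i$ with $\sigma_i=j$, in the order in which they appear in $\pi_j$, and ends at $t$. Let $n_j=|\{i:\sigma_i=j\}|$, let $p^j_i$ be the $i$-th player visited by bus $j$, and put $p^j_{n_j+1}=t$. The cost of the player $p^j_k$ is $c_{p^j_k}(\sigma)=\sum_{l=k}^{n_j} d(p^j_l,p^j_{l+1})$, the distance travelled by her bus from her location to $t$. The social cost function $D$ is $D(\sigma)=\sum_{j=1}^m\sum_{i=1}^{n_j} d(p^j_i,p^j_{i+1})$. Sequential version. Players choose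 buses in the order $1,2,\dots,n$, each observing all earlier choices. A strategy of player $i$ is a function $\lambda_i$ assigning a bus to each possible history $\sigma_{<i}=(\sigma_1,\dots,\sigma_{i-1})\in M^{i-1}$; a strategy profile is $\lambda=(\lambda_1,\dots,\lambda_n)$. Its outcome is the $\sigma$ with $\sigma_i=\lambda_i(\sigma_{<i})$ for all $i$. A strategy profile $\lambda$ is a subgame perfect equilibrium (SPE) if for every player $i$ and every history $\sigma_{<i}$, player $i$ cannot decrease her cost by choosing a bus other than $\lambda_i(\sigma_{<i})$ after the history $\sigma_{<i}$, when players $i+1,\dots,n$ then play according to $\lambda_{i+1},\dots,\lambda_n$. An SPE always exists. For a social cost function $f$, $f(\lambda)$ denotes $f$ of the outcome of $\lambda$. With $\sigma^*\in\mathcal{P}$ minimizing $f$, $\mathrm{SPoS}(f,\Gamma)=\min_{\lambda\in \mathrm{SPE}(\Gamma)} f(\lambda)/f(\sigma^* )$, and for a class $\mathcal{G}$ of games $\mathrm{SPoS}(f,\mathcal{G})=\sup_{\Gamma\in\mathcal{G}}\mathrm{SPoS}(f,\Gamma)$, the supremum being over the $\Gamma\in\mathcal{G}$ with $f(\sigma^* )>0$. *)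

(* Defs.v *)
From HB Require Import structures.
From mathcomp Require Import all_boot all_order all_algebra all_fingroup.
From mathcomp Require Import classical_sets reals constructive_ereal ereal.

Set Implicit Arguments.
Unset Strict Implicit.
Unset Printing Implicit Defensive.

Import Order.TTheory GRing.Theory Num.Theory.

Local Open Scope ring_scope.

Inductive vertex (n : nat) : Type :=
  | Source
  | Destination
  | Player of 'I_n.
Arguments Source {n}.
Arguments Destination {n}.

(* Players and buses are numbered from 0; [bus_order j k] is the player in
   position [k] of the permutation of bus [j]. *)
Record game (R : realType) (n : nat) := Game {
  nbus : nat;
  nbus_ge2 : (2 <= nbus)%N;
  dist : vertex n -> vertex n -> R;
  dist_ge0 : forall x y, 0 <= dist x y;
  dist_sym : forall x y, dist x y = dist y x;
  dist_xx : forall x, dist x x = 0;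
  bus_order : 'I_nbus -> 'S_n
}.

Definition metric (R : realType) (n : nat) (G : game R n) : Prop :=
  forall x y w, dist G x w <= dist G x y + dist G y w.

Definition same_order (R : realType) (n : nat) (G : game R n) : Prop :=
  forall j k : 'I_(nbus G), bus_order j = bus_order k.

Section Game.
Variables (R : realType) (n : nat) (G : game R n).

Let M := 'I_(nbus G).

Definition outcome := {ffun 'I_n -> M}.

Definition route (sigma : outcome) (j : M) : seq 'I_n :=
  [seq i <- [seq bus_order j k | k <- enum 'I_n] | sigma i == j].

(* The default value of [nth] makes the stop after the last player the
   destination. *)
Definition stop (sigma : outcome) (j : M) (l : nat) : vertex n :=
  nth Destination [seq Player i | i <- route sigma j] l.

Definition cost (i : 'I_n) (sigma : outcome) : R :=
  let j := sigma i in
  let r := route sigma j in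
  \sum_(index i r <= l < size r) dist G (stop sigma j l) (stop sigma j l.+1).

Definition total_distance (sigma : outcome) : R :=
  \sum_(j : M) \sum_(0 <= l < size (route sigma j))
    dist G (stop sigma j l) (stop sigma j l.+1).

(* Player [i] has exactly [i] predecessors. *)
Definition profile := {dffun forall i : 'I_n, {ffun i.-tuple M -> M}}.

Definition history (sigma : outcome) (i : 'I_n) : i.-tuple M :=
  [tuple sigma (widen_ord (ltnW (ltn_ord i)) k) | k < i].

Definition move (lambda : profile) (sigma : outcome) (i : 'I_n) : outcome :=
  [ffun k => if k == i then lambda i (history sigma i) else sigma k].

Definition bus0 : M := Ordinal (ltnW (nbus_ge2 G)).

(* The initial outcome is irrelevant: all its entries get overwritten before
   they are read, see [outcome_ofP]. *)
Definition outcome_of (lambda : profile) : outcome :=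
  foldl (move lambda) [ffun=> bus0] (enum 'I_n).

(* Outcome when player [i] takes bus [b] after the history [h] and the players
   after [i] follow [lambda].  In the initial outcome, entries below [i] are
   those of [h], the entry at [i] is [b] (the default value of [nth]), and the
   later ones are overwritten; see [outcome_afterP]. *)
Definition outcome_after (lambda : profile) (i : 'I_n) (h : i.-tuple M)
    (b : M) : outcome :=
  foldl (move lambda) [ffun k : 'I_n => nth b h k]
    [seq k : 'I_n <- enum 'I_n | (i < k)%N].

Definition SPE (lambda : profile) : bool :=
  [forall i : 'I_n, forall h : i.-tuple M, forall b : M,
    cost i (outcome_after lambda h (lambda i h))
      <= cost i (outcome_after lambda h b)].

Lemma eq_history (s s' : outcome) (i : 'I_n) :
  (forall k : 'I_n, (k < i)%N -> s k = s' k) -> history s i = history s' i.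
Proof.
move=> e; apply: eq_from_tnth => k; rewrite !tnth_mktuple; apply: e.
exact: (ltn_ord k).
Qed.

Lemma foldl_moveP (lambda : profile) (s : outcome) (r : seq 'I_n) :
  sorted (fun i k : 'I_n => (i < k)%N) r ->
  let s' := foldl (move lambda) s r in
  forall i, s' i = if i \in r then lambda i (history s' i) else s i.
Proof.
elim: r s => [|a r IH] s //= pr i.
have ptr : transitive (fun i k : 'I_n => (i < k)%N).
  by move=> x y z; apply: ltn_trans.
have /allP amin := order_path_min ptr pr.
have anr : a \notin r by apply/negP => /amin; rewrite ltnn.
have {}IH := IH (move lambda s a) (path_sorted pr).
rewrite IH inE; case: ifPn => [ir|nir]; first by rewrite orbT.
rewrite orbF ffunE; case: eqP => [->|] //; congr (lambda a _).
apply: eq_history => k ka; rewrite IH ifN.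
  by rewrite ffunE ifN //; apply: contraTneq ka => ->; rewrite ltnn.
by apply/negP => /amin; rewrite ltnNge (ltnW ka).
Qed.

Lemma sorted_enum_ord : sorted (fun i k : 'I_n => (i < k)%N) (enum 'I_n).
Proof.
have := iota_ltn_sorted 0 n; rewrite -val_enum_ord sorted_map; exact.
Qed.

Lemma outcome_ofP (lambda : profile) (sigma : outcome) :
  sigma = outcome_of lambda <->
  forall i, sigma i = lambda i (history sigma i).
Proof.
have out i : outcome_of lambda i = lambda i (history (outcome_of lambda) i).
  have := foldl_moveP lambda [ffun=> bus0] sorted_enum_ord i.
  by rewrite mem_enum inE.
split=> [-> //|e]; apply/ffunP => i.
have [m] := ubnP (nat_of_ord i).
elim: m i => // m IH i; rewrite ltnS => im.
rewrite e out; congr (lambda i _); apply: eq_history => k ki.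
exact: IH (leq_trans ki im).
Qed.

Lemma outcome_afterP (lambda : profile) (i : 'I_n) (h : i.-tuple M) (b : M)
    (sigma := outcome_after lambda h b) :
  [/\ history sigma i = h, sigma i = b &
      forall k : 'I_n, (i < k)%N -> sigma k = lambda k (history sigma k)].
Proof.
have ptr : transitive (fun i k : 'I_n => (i < k)%N).
  by move=> x y z; apply: ltn_trans.
have E := foldl_moveP lambda [ffun k : 'I_n => nth b h k]
  (sorted_filter ptr (fun k : 'I_n => (i < k)%N) sorted_enum_ord).
split.
- apply: eq_from_tnth => k; rewrite tnth_mktuple /sigma E.
  rewrite mem_filter /= ltnNge (ltnW (ltn_ord k)) /= ffunE /=.
  by rewrite -tnth_nth.
- by rewrite /sigma E mem_filter ltnn /= ffunE nth_default // size_tuple.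
- by move=> k ik; rewrite /sigma E mem_filter ik mem_enum inE.
Qed.

Lemma eq_outcome_after (l l' : profile) (i : 'I_n) (h : i.-tuple M) (b : M) :
  (forall k : 'I_n, (i < k)%N -> l k = l' k) ->
  outcome_after l h b = outcome_after l' h b.
Proof.
move=> e; rewrite /outcome_after.
have: {in [seq k : 'I_n <- enum 'I_n | (i < k)%N], forall k, l k = l' k}.
  by move=> k; rewrite mem_filter => /andP[/e].
elim: [seq k <- _ | _] (finfun _) => [//|a r IH] s er /=.
rewrite /move er ?mem_head // IH // => k kr.
by rewrite er // inE kr orbT.
Qed.

Lemma SPE_exists : exists lambda, SPE lambda.
Proof.
suff /(_ n (leqnn n)) [l lP] : forall p, (p <= n)%N ->
    exists l : profile, forall i : 'I_n, (n - p <= i)%N ->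
    forall (h : i.-tuple M) b,
    cost i (outcome_after l h (l i h)) <= cost i (outcome_after l h b).
  exists l; apply/forallP => i; apply/forallP => h; apply/forallP => b.
  by apply: lP; rewrite subnn.
elim=> [|p IH] pn.
  exists [ffun i : 'I_n => [ffun h : i.-tuple M => bus0]] => i.
  by rewrite subn0 leqNgt ltn_ord.
have [l lP] := IH (ltnW pn).
pose l' : profile := [ffun i : 'I_n => [ffun h : i.-tuple M =>
  if nat_of_ord i == (n - p.+1)%N
  then [arg min_(b < bus0) cost i (outcome_after l h b)]%O else l i h]].
have l'E (k : 'I_n) : (n - p.+1 < k)%N -> l k = l' k.
  by move=> pk; apply/ffunP => h; rewrite !ffunE gtn_eqF.
have aE (i : 'I_n) (h : i.-tuple M) b : (n - p.+1 <= i)%N ->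
    outcome_after l' h b = outcome_after l h b.
  move=> pi; apply/esym/eq_outcome_after => k ik.
  by apply: l'E; apply: leq_ltn_trans ik.
exists l' => i pi h b; rewrite !aE //.
move: pi; rewrite leq_eqVlt => /predU1P[ip|pi].
  by rewrite !ffunE ifT ?ip //; case: arg_minP => // b0 _; apply.
rewrite -l'E //; apply: lP.
by move: pi; rewrite -subSn // subSS.
Qed.

End Game.

Definition social_cost (R : realType) (n : nat) :=
  forall G : game R n, outcome G -> R.

Definition optimum (R : realType) (n : nat) (f : social_cost R n)
    (G : game R n) : outcome G :=
  [arg min_(sigma < [ffun=> bus0 G]) f G sigma]%O.

Definition SPoS (R : realType) (n : nat) (f : social_cost R n)
    (G : game R n) : R :=
  let ratio (lambda : profile G) :=
    f G (outcome_of lambda) / f G (optimum f G) in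
  ratio [arg min_(lambda < xchoose (SPE_exists G) | SPE lambda) ratio lambda]%O.

Definition SPoS_class (R : realType) (n : nat) (f : social_cost R n)
    (C : set (game R n)) : \bar R :=
  ereal_sup [set (SPoS f G)%:E | G in
    [set G | C G /\ 0 < f G (optimum f G)]]%classic.

(* Main.v *)
(* All players sit at mutual distance [e] and at distance 1 from the destination,
   there are more buses than players, and every bus visits the players in the
   reverse of the order in which they choose.  Then a player's cost depends only
   on the earlier choices, and she strictly prefers a bus that is still empty to
   one that is not, so in every SPE the buses are distinct and the social cost
   is [n].  Sharing one bus costs [1 + (n - 1) e]; let [e] tend to 0. *)
Require Import Defs.
From mathcomp Require Import all_boot all_order all_algebra all_fingroup.
From mathcomp Require Import classical_sets reals constructive_ereal ereal.
From mathcomp Require Import lra.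

Set Implicit Arguments.
Unset Strict Implicit.
Unset Printing Implicit Defensive.

Import Order.TTheory GRing.Theory Num.Theory.

Local Open Scope ring_scope.

Section ClusterGame.
Variables (R : realType) (n : nat) (e : R).
Hypotheses (n_gt0 : (0 < n)%N) (e_gt0 : 0 < e) (e_le1 : e <= 1).

Definition cluster_dist (x y : vertex n) : R :=
  match x, y with
  | Source, Source | Destination, Destination => 0
  | Player i, Player k => if i == k then 0 else e
  | _, _ => 1
  end.

Lemma cluster_dist_ge0 x y : 0 <= cluster_dist x y.
Proof. by case: x y => [||i] [||k] //=; case: eqP => // _; apply: ltW. Qed.

Lemma cluster_dist_sym x y : cluster_dist x y = cluster_dist y x.
Proof. by case: x y => [||i] [||k] //=; rewrite eq_sym. Qed.

Lemma cluster_dist_xx x : cluster_dist x x = 0.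
Proof. by case: x => [||i] //=; rewrite eqxx. Qed.

Lemma cluster_dist_triangle x y z :
  cluster_dist x z <= cluster_dist x y + cluster_dist y z.
Proof.
move: e_gt0 e_le1 => e0 e1.
case: x y z => [||i] [||j] [||k] //=; try lra; try by case: eqP => _; lra.
case: (eqVneq i k) => [_|ik]; first by do 2!case: eqP => _; lra.
case: (eqVneq i j) => [<-|_]; first by rewrite (negPf ik); lra.
by case: eqP => _; lra.
Qed.

(** There are [n.+1] buses, and [n_gt0] is convertible to the required [2 <= n.+1]. *)
Definition cluster_game : game R n :=
  @Game R n n.+1 n_gt0 cluster_dist cluster_dist_ge0 cluster_dist_sym
    cluster_dist_xx (fun=> perm (@rev_ord_inj n)).

Local Notation G := cluster_game.

Lemma cluster_game_metric : metric G.
Proof. exact: cluster_dist_triangle. Qed.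

Lemma cluster_game_same_order : same_order G.
Proof. by []. Qed.

Lemma gt_ord_trans : transitive (fun i k : 'I_n => (k < i)%N).
Proof. by move=> x y z yx zx; apply: ltn_trans zx yx. Qed.

Lemma sorted_route (s : outcome G) j :
  sorted (fun i k : 'I_n => (k < i)%N) (route s j).
Proof.
apply: (sorted_filter gt_ord_trans); rewrite sorted_map.
have := sorted_enum_ord n; apply: sub_sorted => i k /= ik.
by rewrite !permE /= ltn_sub2l // (leq_ltn_trans ik).
Qed.

Lemma mem_route (s : outcome G) j i : (i \in route s j) = (s i == j).
Proof.
rewrite mem_filter; case: eqP => //= _; apply/mapP.
by exists (rev_ord i); rewrite ?mem_enum // permE rev_ordK.
Qed.

Lemma uniq_route (s : outcome G) j : uniq (route s j).
Proof.
by apply: filter_uniq; rewrite map_inj_uniq ?enum_uniq //; apply: perm_inj.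
Qed.

(** Stops on a route are distinct players, so every leg has length [e] except the last, which leads
    to [Destination] (the default value of [nth] in [stop]) and has length 1. *)
Lemma distance_to_go (s : outcome G) j k (r := route s j) : (k < size r)%N ->
  \sum_(k <= l < size r) dist G (stop s j l) (stop s j l.+1)
    = e *+ (size r - k.+1) + 1.
Proof.
pose x0 := Ordinal n_gt0; case Dp: (size r) => [//|p]; rewrite ltnS => kp.
rewrite big_nat_recr //= subSS; congr (_ + _).
  rewrite -sumr_const_nat; apply: eq_big_nat => l /andP[_ lp].
  rewrite /stop -/r !(nth_map x0) ?Dp ?ltnS //; last exact: ltnW.
  by rewrite /= nth_uniq ?uniq_route ?Dp ?ltnS ?(ltnW lp) // ltn_eqF.
rewrite /stop -/r (nth_map x0) ?Dp //.
by rewrite [X in cluster_dist _ X]nth_default // size_map Dp.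
Qed.

(** A player pays 1 plus [e] for each player visited after her, and routes run through decreasing
    indices, so these are the earlier choosers on her bus. *)
Lemma cost_le1 (s : outcome G) (i : 'I_n) :
  reflect (forall k : 'I_n, (k < i)%N -> s k != s i) (cost i s <= 1).
Proof.
have ir : i \in route s (s i) by rewrite mem_route.
rewrite /cost distance_to_go ?index_mem // gerDr.
have := sorted_route s (s i); have := uniq_route s (s i).
have := mem_route s (s i).
(* Around [i], the part [r1] holds larger indices and [r2] smaller ones; the cost is at most 1
   exactly when [r2] is empty, and otherwise the head of [r2] is a counterexample to the right-hand
   condition. *)
case/splitPr: ir => r1 r2 memr; rewrite cat_uniq /= => /and4P[_ + ir2 _].
rewrite negb_or => /andP[ir1 _] srt.
rewrite index_cat (negPf ir1) /= eqxx addn0 size_cat /= addnS subSS addKn.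
have pw : pairwise (fun i k : 'I_n => (k < i)%N) (r1 ++ i :: r2).
  by rewrite -(sorted_pairwise gt_ord_trans).
move: pw; rewrite pairwise_cat /= => /and4P[/allrelP r1i _ /allP ri _].
case: r2 => [|k r2] in memr ir2 srt r1i ri *.
  rewrite mulr0n lexx; apply: ReflectT => k ki.
  rewrite -memr mem_cat mem_seq1 negb_or.
  apply/andP; split; last by apply: contraTneq ki => ->; rewrite ltnn.
  apply/negP => kr1; have := r1i k i kr1 (mem_head _ _).
  by rewrite ltnNge (ltnW ki).
rewrite leNgt pmulrn_lgt0 // e_gt0; apply: ReflectF => /(_ k).
by rewrite ri ?mem_head // -memr mem_cat !inE eqxx !orbT => /(_ isT).
Qed.

(** Each bus in use pays at least its final leg of length 1. *)
Lemma leq_total_distance (s : outcome G) :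
  (#|[set s i | i : 'I_n]|)%:R <= total_distance s.
Proof.
rewrite -sum1_card natr_sum big_mkcond; apply: ler_sum => j _.
case: ifP => [/imsetP[i _ ->]|_]; last first.
  by apply: sumr_ge0 => l _; apply: dist_ge0.
have ir : i \in route s (s i) by rewrite mem_route.
rewrite distance_to_go; last by case: (route _ _) ir.
by rewrite lerDr mulrn_wge0 // ltW.
Qed.

Lemma total_distance_shared :
  total_distance [ffun=> bus0 G] = e *+ n.-1 + 1 :> R.
Proof.
set s := [ffun=> bus0 G].
have rE j : route s j = if j == bus0 G then route s (bus0 G) else [::].
  case: eqP => [-> //|jb]; case Dr: (route s j) => [//|x r].
  have := mem_head x r; rewrite -Dr mem_route ffunE => /eqP jb'.
  by case: jb.
rewrite /total_distance (bigD1 (bus0 G)) //= [X in _ + X]big1 ?addr0; last first.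
  by move=> j /negPf jb; rewrite rE jb big_geq.
have sz : size (route s (bus0 G)) = n.
  rewrite -(card_uniqP (uniq_route _ _)) -[RHS]card_ord; apply: eq_card => i.
  by rewrite mem_route ffunE eqxx.
by rewrite distance_to_go sz // subn1.
Qed.

Lemma SPE_injective (lambda : profile G) :
  SPE lambda -> injective (outcome_of lambda).
Proof.
move=> /forallP spe; set s := outcome_of lambda.
have sE : forall i, s i = lambda i (history s i) by apply/outcome_ofP.
suff ne (i k : 'I_n) : (k < i)%N -> s k != s i.
  move=> i k sik; apply: val_inj; apply/eqP; apply: contraT.
  by rewrite neq_ltn => /orP[] /ne; rewrite sik eqxx.
have histE s' : history s' i = history s i ->
    forall k : 'I_n, (k < i)%N -> s' k = s k.
  move=> hs k' ki; have := congr1 (fun t => tnth t (Ordinal ki)) hs.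
  by rewrite !tnth_mktuple; congr (_ = _); congr (_ _); apply: val_inj.
(* Pigeonhole: [n] players cannot fill [n.+1] buses. *)
have [b bP] : exists b, forall k : 'I_n, s k != b.
  have /subsetPn[b _ bs] : ~~ ([set: 'I_(nbus G)] \subset [set s i | i : 'I_n]).
    apply/negP => /subset_leq_card; rewrite cardsT card_ord leqNgt ltnS.
    by rewrite (leq_trans (leq_imset_card _ _)) // card_ord.
  by exists b => k'; apply: contraNneq bs => <-; apply: imset_f.
have [hb ib _] := outcome_afterP lambda (history s i) b.
have [hi ii _] := outcome_afterP lambda (history s i) (s i).
have /forallP/(_ b) := forallP (spe i) (history s i).
(* Deviating to the empty bus [b] costs at most 1 however the later players react, so the
   equilibrium choice [s i] costs at most 1 too, and [cost_le1] keeps it off the buses of earlier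
   players. *)
rewrite -sE => /le_trans le1 ki.
have /le1/cost_le1/(_ k ki) : cost i (outcome_after lambda (history s i) b) <= 1.
  by apply/cost_le1 => k' k'i; rewrite ib (histE _ hb).
by rewrite ii (histE _ hi).
Qed.

Lemma optimum_gt0 : 0 < total_distance (optimum (@total_distance R n) G).
Proof.
apply: lt_le_trans (leq_total_distance _).
rewrite ltr0n card_gt0; apply/set0Pn.
by exists (optimum (@total_distance R n) G (Ordinal n_gt0)); apply: imset_f.
Qed.

Lemma SPoS_cluster_game :
  n%:R / (e *+ n.-1 + 1) <= SPoS (@total_distance R n) G.
Proof.
rewrite /SPoS; case: arg_minP => [|lambda spe _]; first exact: xchooseP.
have opt_le : total_distance (optimum (@total_distance R n) G) <= e *+ n.-1 + 1.
  rewrite -total_distance_shared /optimum.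
  by case: arg_minP => // s _; apply.
have := leq_total_distance (outcome_of lambda).
(* By injectivity [n] buses are in use, so the numerator is at least [n]; the optimum is at most the
   cost of sharing one bus. *)
rewrite card_imset ?card_ord; last exact: SPE_injective.
move=> n_le; apply: ler_pM => //; rewrite ?invr_ge0 ?ler0n //.
  by rewrite addr_ge0 // mulrn_wge0 // ltW.
rewrite lef_pV2 ?posrE ?optimum_gt0 //.
exact: lt_le_trans optimum_gt0 opt_le.
Qed.

End ClusterGame.

Theorem proposition3p2 (R : realType) (n : nat) (hn : (1 <= n)%N) :
  ((n%:R : R)%:E <= SPoS_class (@total_distance R n)
     [set G : game R n | metric G /\ same_order G])%E.
Proof.
have n0 : 0 < n%:R :> R by rewrite ltr0n.
apply/lee_addgt0Pr => d d0.
(* With [e = d / a], the term [d] in [a] gives [e <= 1], and [n * n] gives [e * n * n <= d], which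
   absorbs the excess cost of the shared bus. *)
pose a : R := n%:R * n%:R + d.
have a0 : 0 < a by rewrite addr_gt0 ?mulr_gt0.
have e0 : 0 < d / a by rewrite divr_gt0.
have e1 : d / a <= 1 by rewrite ler_pdivrMr // mul1r lerDr mulr_ge0 ?ler0n.
have ea : d / a * a = d by rewrite divfK // gt_eqF.
have sup_ge : ((SPoS (@total_distance R n) (cluster_game hn e0))%:E <=
    SPoS_class (@total_distance R n)
     [set G : game R n | metric G /\ same_order G])%E.
  apply: ereal_sup_ubound; exists (cluster_game hn e0) => //.
  split; last exact: optimum_gt0.
  by split; [exact: cluster_game_metric | exact: cluster_game_same_order].
apply: (le_trans _ (leeD2r d%:E sup_ge)); rewrite -EFinD lee_fin.
rewrite -lerBlDr; apply: le_trans (SPoS_cluster_game hn e0).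
have m0 : 0 <= d / a *+ n.-1 by rewrite mulrn_wge0 // ltW.
rewrite ler_pdivlMr; last by rewrite ltr_wpDl.
have : d / a *+ n.-1 <= d / a * n%:R.
  by rewrite -mulr_natr ler_pM2l // ler_nat leq_pred.
move: ea; rewrite /a; clear sup_ge; move: (d / a) (d / a *+ n.-1) e0 m0.
move=> x y x0 y0 xa yx.
(* The goal [(n - d) * (y + 1) <= n] amounts to [n * y <= d + d * y]; these products make it linear,
   since [xa] reads [x * n * n = d - x * d]. *)
have yn : y * n%:R <= x * n%:R * n%:R by rewrite ler_pM2r.
have xd : 0 <= x * d by rewrite mulr_ge0 // ltW.
have yd : 0 <= y * d by rewrite mulr_ge0 // ltW.
lra.
Qed.
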